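(* Let $\ell\in\mathbb{N}$ and let $s>1$ be real. For $M\geq 1$ let \[ P_{\ell}(s;M):=\sum_{k\in \Omega(\ell):\, k\geq M}\frac{1}{k^{s}}, \] where $\Omega(\ell)$ is the set of positive integers with at most $\ell$ (not necessarily distinct) prime factors. Then there exist constants $C_1,C_2>0$ and $M_0$ such that for every $M\geq M_0$, \[ C_1\,\frac{(\log\log M)^{\ell-1}}{M^{s-1}\log M}\;\leq\; P_{\ell}(s;M)\;\leq\; C_2\,\frac{(\log\log M)^{\ell-1}}{M^{s-1}\log M}. \]
   Context: $\Omega(\ell)$ denotes the set of $\ell$-almost primes: positive integers with at most $\ell$ prime factors counted with multiplicity (e.g. $\Omega(1)$ is the set of primes, and $4,6\in\Omega(2)$). *)

(* Defs.v *)
From mathcomp Require Import ssreflect ssrbool ssrnat seq bigop prime.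
From Stdlib Require Import Reals.
From Coquelicot Require Import Coquelicot.

Definition bigomega (n : nat) : nat :=
  \sum_(p <- primes n) logn p n.

Definition almost_prime (l k : nat) : bool :=
  leq 1 k && leq (bigomega k) l.

Open Scope R_scope.

Definition P_term (l : nat) (s M : R) (k : nat) : R :=
  if almost_prime l k && Rle_dec M (INR k) then / Rpower (INR k) s else 0.

Definition P_sum (l : nat) (s M : R) : R := Series (P_term l s M).

(* Main.v *)
(** Weighting by the logarithm linearises the problem: if [k] has at most [l] prime factors then
    [ln k <= l * \sum_(p | k) ln p], so writing [k = p m] with [m] having at most [l - 1] prime
    factors,
<<
      ln M * P_l(s; M) <= l * \sum_m m^(-s) * \sum_(p >= M / m) p^(-s) ln p.
>>
    Chebyshev's bound [\sum_(p < x) ln p = O(x)] makes the inner sum [O((M / m)^(1 - s))] for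
    [m <= M], so the right-hand side is [O(M^(1 - s) * \sum_(m <= M) 1 / m)] up to the terms
    [m > M], which contribute [O(M^(1 - s))].  In the other direction every [k] is of the form
    [p m] in at most [l] ways, so [l * P_l(s; M)] dominates the sum of [(p m)^(-s)] over
    [m < sqrt M] and [p >= M / m], and the lower bound
    [\sum_(p >= y) p^(-s) >= c * y^(1 - s) / ln y] again leaves [\sum_m 1 / m].  The sum of [1 / m]
    over [m < x] with at most [j] prime factors has order [(ln ln x)^j]: the same double counting
    of [m = p m'] reduces this to [\sum_(p < x) 1 / p = ln ln x + O(1)], which follows by partial
    summation from Mertens' estimate [\sum_(p < x) ln p / p = ln x + O(1)]. *)

From mathcomp Require all_boot all_order all_algebra unstable classical_sets.
From mathcomp Require reals ereal normedtype sequences exp Rstruct_topology.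
From mathcomp Require zify ring lra.
Require Import Defs.
From Stdlib Require Import Reals Lra.
From Coquelicot Require Import Coquelicot.
Open Scope R_scope.

(* The module confines the [ssrnat] notations, which would change the reading of [(1 <= l)%nat]
   in the theorem. *)
Module AlmostPrimes.
Import all_boot all_order all_algebra unstable classical_sets.
(* [Rstruct_topology] goes first: it has homonyms, about Stdlib's [exp], of lemmas on [expR]. *)
Import Rstruct_topology reals ereal normedtype sequences exp.
Import zify ring lra.
Import Order.TTheory GRing.Theory Num.Theory numFieldNormedType.Exports.

Set Implicit Arguments.
Unset Strict Implicit.
Unset Printing Implicit Defensive.

Local Open Scope classical_set_scope.
Local Open Scope ring_scope.

(** * Primorials and factorials *)

Lemma prime_dvd_fact p n : prime p -> (p %| n`!)%N = (p <= n)%N.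
Proof.
move=> p_prime; elim: n => [|n IHn].
  by rewrite fact0 Euclid_dvd1 // leqNgt prime_gt0.
rewrite factS Euclid_dvdM // IHn; apply/orP/idP => [[/dvdn_leq->|/leqW]//|].
by rewrite leq_eqVlt ltnS => /orP[/eqP->|]; [left | right].
Qed.

Lemma pairwise_coprime_primes (r : seq nat) : uniq r -> all prime r -> pairwise coprime r.
Proof.
rewrite uniq_pairwise => r_uniq r_prime; apply: sub_in_pairwise r_prime r_uniq => p q.
by move=> p_prime q_prime p_neq_q; rewrite prime_coprime // dvdn_prime2.
Qed.

Lemma bin_doubleS_le m : ('C(m.*2.+1, m) <= 4 ^ m)%N.
Proof.
have sum2 : ('C(m.*2.+1, m) + 'C(m.*2.+1, m.+1) <= 2 ^ m.*2.+1)%N.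
  rewrite -[2%N]/(1 + 1)%N expnDn.
  under eq_bigr => i _ do rewrite !exp1n !muln1.
  rewrite -(big_mkord xpredT (fun i => 'C(m.*2.+1, i))) (big_cat_nat (n := m)) //=; last lia.
  rewrite [X in (_ <= _ + X)%N]big_ltn; last lia.
  by rewrite [X in (_ <= _ + (_ + X))%N]big_ltn; lia.
have binC : 'C(m.*2.+1, m.+1) = 'C(m.*2.+1, m).
  by rewrite -bin_sub; [congr 'C(_, _); lia | lia].
move: sum2; rewrite binC expnS -mul2n expnM -[(2 ^ 2)%N]/4%N; lia.
Qed.

Lemma primorial_le n : (\prod_(0 <= p < n.+1 | prime p) p <= 4 ^ n)%N.
Proof.
elim/ltn_ind: n => n IHn.
have [n_le2|n_gt2] := leqP n 2; first by case: n n_le2 {IHn} => [|[|[|]]] //; rewrite unlock.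
have [n_odd|n_even] := boolP (odd n); last first.
  case: n n_even n_gt2 IHn => // n n_even n_gt2 IHn.
  have /negbTE nP : ~~ prime n.+1 by apply/negP => /even_prime; lia.
  by rewrite big_mkcond big_nat_recr //= -big_mkcond nP muln1 (leq_trans (IHn n _)) // leq_exp2l.
have [m m_gt0 def_n] : exists2 m, (0 < m)%N & n = m.*2.+1 by exists n./2; lia.
rewrite def_n (big_cat_nat (n := m.+2)) /=; [|lia|lia].
rewrite -addnn -addnS addnC expnD leq_mul //; first by apply: IHn; lia.
apply: leq_trans (bin_doubleS_le m); apply: dvdn_leq; first by rewrite bin_gt0; lia.
(* The primes in (m + 1, 2 m + 1] all divide the binomial coefficient. *)
apply/Gauss_dvd_prod => [|p].
  rewrite map_id pairwise_coprime_primes ?filter_all //.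
  exact/filter_uniq/iota_uniq.
rewrite mem_index_iota => p_range p_prime.
have : (p %| (m.*2.+1)`!)%N by apply: dvdn_fact; lia.
rewrite -(bin_fact (m := m)); last lia.
rewrite !Euclid_dvdM // !prime_dvd_fact //; lia.
Qed.

Lemma logn_fact_le p n : prime p -> (p.-1 * logn p n`! <= n)%N.
Proof.
move=> p_prime; rewrite logn_fact //.
suff sum_le m : (p.-1 * (\sum_(1 <= k < m.+1) n %/ p ^ k) + n %/ p ^ m <= n)%N.
  exact: leq_trans (leq_addr _ _) (sum_le n).
elim: m => [|m IHm]; first by rewrite big_geq // muln0 expn0 divn1.
rewrite big_nat_recr //= expnSr divnMA.
have := leq_trunc_div (n %/ p ^ m) p; have := prime_gt0 p_prime; nia.
Qed.

Lemma logn_fact_ge p n : prime p -> (n %/ p <= logn p n`!)%N.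
Proof.
move=> p_prime; case: n => [|n]; first by rewrite div0n.
by rewrite logn_fact // big_ltn // expn1 leq_addr.
Qed.

Lemma fact_le_exp n : (n`! <= n ^ n)%N.
Proof.
have [->//|n_gt0] := posnP n.
rewrite fact_prod; apply: (@leq_trans (\prod_(1 <= i < n.+1) n)); last first.
  by rewrite prod_nat_const_nat subn1.
by rewrite big_nat_cond [leqRHS]big_nat_cond; apply: leq_prod => i; lia.
Qed.

Lemma big_primes_range (T : Type) (idx : T) (op : Monoid.com_law idx) n K (F : nat -> T) :
  (0 < n)%N -> (forall p, prime p -> (p %| n)%N -> (p < K)%N) ->
  \big[op/idx]_(p <- primes n) F p = \big[op/idx]_(0 <= p < K | prime p && (p %| n)%N) F p.
Proof.
move=> n_gt0 dvd_lt; rewrite -[RHS]big_filter; apply/perm_big/uniq_perm.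
- exact: primes_uniq.
- exact/filter_uniq/iota_uniq.
move=> p; rewrite mem_filter mem_index_iota mem_primes n_gt0 /=.
by case: (boolP (prime p)) => //= p_prime; case: (boolP (p %| n)%N) => //= /dvd_lt->.
Qed.

Lemma ler_sum_nat_subset (R : numDomainType) m n m' n' (P Q : pred nat) (F : nat -> R) :
  (forall i, (m <= i < n)%N -> P i -> (m' <= i < n')%N && Q i) ->
  (forall i, (m' <= i < n')%N -> Q i -> 0 <= F i) ->
  \sum_(m <= i < n | P i) F i <= \sum_(m' <= i < n' | Q i) F i.
Proof.
move=> sub F_ge0; pose N := maxn n n'.
rewrite (big_nat_widenl m 0) // (big_nat_widen 0 n N) ?leq_maxl //.
rewrite (big_nat_widenl m' 0) // (big_nat_widen 0 n' N) ?leq_maxr //.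
rewrite [leLHS]big_mkcond [leRHS]big_mkcond; apply: ler_sum => i _.
case: ifP => [/andP[/andP[Pi mi] ni]|_].
  by have /andP[/andP[-> ->] ->] := sub i (introT andP (conj mi ni)) Pi.
by case: ifP => // /andP[/andP[Qi mi] ni]; apply: F_ge0 => //; apply/andP.
Qed.

Section Logarithm.
Variable R : realType.
Implicit Types x y : R.

Lemma ler_lnB x y : 0 < x -> 0 < y -> ln y - ln x <= (y - x) / x.
Proof.
move=> x_gt0 y_gt0; rewrite -ln_div //.
have -> : y / x = 1 + (y - x) / x by field; lra.
apply: le_ln1Dx; rewrite ltr_pdivlMr //; lra.
Qed.

Lemma ger_lnB x y : 0 < x -> 0 < y -> (y - x) / y <= ln y - ln x.
Proof. by move=> x_gt0 y_gt0; have := ler_lnB y_gt0 x_gt0; rewrite -(opprB y x) mulNr; lra. Qed.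

Lemma ln2_bounds : 2^-1 <= (ln 2 : R) <= 1.
Proof.
have := ger_lnB ltr01 (ltr0Sn R 1); have := ler_lnB ltr01 (ltr0Sn R 1).
by rewrite ln1; lra.
Qed.

Lemma ln_prod (I : Type) (r : seq I) (P : pred I) (F : I -> R) :
  (forall i, P i -> 0 < F i) -> ln (\prod_(i <- r | P i) F i) = \sum_(i <- r | P i) ln (F i).
Proof.
move=> F_gt0; pose is_ln (x y : R) := 0 < x /\ ln x = y.
suff [] : is_ln (\prod_(i <- r | P i) F i) (\sum_(i <- r | P i) ln (F i)) by [].
apply: (big_ind2 is_ln) => [|x y u v [x_gt0 <-] [u_gt0 <-]|i Pi]; first by rewrite /is_ln ln1.
  by split; [exact: mulr_gt0 | rewrite lnM].
by split=> //; exact: F_gt0.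
Qed.

Lemma ln_nat_prime_decomp n : (0 < n)%N ->
  ln n%:R = \sum_(p <- primes n) (logn p n)%:R * ln p%:R :> R.
Proof.
move=> n_gt0; rewrite {1}(prod_prime_decomp n_gt0) prime_decompE big_map /= natr_prod.
rewrite big_seq [RHS]big_seq ln_prod => [|p]; last first.
  by rewrite mem_primes natrX => /andP[p_prime _]; rewrite exprn_gt0 // ltr0n prime_gt0.
apply: eq_bigr => p; rewrite mem_primes => /andP[p_prime _].
by rewrite natrX lnXn ?ltr0n ?prime_gt0 // mulr_natl.
Qed.

Lemma ln_prime_gt0 p : prime p -> 0 < ln p%:R :> R.
Proof. by move=> /prime_gt1 p_gt1; rewrite ln_gt0 // ltr1n. Qed.

Lemma ln_nat_ge0 n : 0 <= ln n%:R :> R.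
Proof. by case: n => [|n]; [rewrite ln0 | rewrite ln_ge0 ?ler1n]. Qed.

Lemma ln_natS_le n : (0 < n)%N -> ln n.+1%:R <= ln n%:R + 1 :> R.
Proof.
move=> n_gt0; have N_ge1 : 1 <= n%:R :> R by rewrite ler1n.
rewrite -lerBlDl -natr1; apply: le_trans (ler_lnB _ _) _; try lra.
by rewrite addrAC subrr add0r ler_pdivrMr; lra.
Qed.

Lemma ln_nat_ge_ln2 n : (2 <= n)%N -> ln 2 <= ln n%:R :> R.
Proof. by move=> n_ge2; rewrite ler_ln ?posrE ?ltr0n ?ler_nat // ltnW. Qed.

Lemma ln_fact n : ln n`!%:R = \sum_(0 <= p < n.+1 | prime p) (logn p n`!)%:R * ln p%:R :> R.
Proof.
rewrite ln_nat_prime_decomp ?fact_gt0 // (big_primes_range _ (K := n.+1)) ?fact_gt0 //.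
  rewrite big_nat_cond [RHS]big_nat_cond; apply: eq_bigl => p.
  have [/andP[_ p_le]|//] := boolP (0 <= p < n.+1)%N.
  by case: (boolP (prime p)) => // p_prime; rewrite prime_dvd_fact.
by move=> p p_prime; rewrite prime_dvd_fact.
Qed.

Lemma ln_fact_le n : ln n`!%:R <= n%:R * ln n%:R :> R.
Proof.
have [->|n_gt0] := posnP n; first by rewrite fact0 ln1 mul0r.
rewrite mulr_natl -lnXn ?ltr0n // -natrX ler_ln ?posrE ?ltr0n ?fact_gt0 ?expn_gt0 ?n_gt0 //.
by rewrite ler_nat fact_le_exp.
Qed.

Lemma ln_fact_ge n : n%:R * ln n%:R - n%:R <= ln n`!%:R :> R.
Proof.
case: n => [|n]; first by rewrite fact0 ln1 mul0r subr0.
set N : R := n.+1%:R; have N_gt0 : 0 < N by rewrite ltr0n.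
have factR_gt0 : 0 < n.+1`!%:R :> R by rewrite ltr0n fact_gt0.
rewrite lerBlDr addrC -lerBlDr mulr_natl -lnXn // -ln_div ?posrE ?exprn_gt0 //.
rewrite -[leRHS]expRK ler_ln ?posrE ?expR_gt0 ?divr_gt0 ?exprn_gt0 //.
by have := expR_ge1Dxn n (ltW N_gt0); lra.
Qed.

End Logarithm.

(** * Chebyshev and Mertens estimates *)

Lemma ler_sum_abel (R : numDomainType) (a f : nat -> R) m n C :
  (forall k, (m <= k)%N -> \sum_(m <= i < k) a i <= C) ->
  (forall k, (m <= k)%N -> 0 <= f k) -> (forall k, (m <= k)%N -> f k.+1 <= f k) ->
  \sum_(m <= i < n) a i * f i <= C * f m.
Proof.
move=> partial_le f_ge0 f_decr.
have C_ge0 : 0 <= C by have := partial_le m (leqnn m); rewrite big_geq.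
have [mn|nm] := leqP m n; last by rewrite big_geq ?(ltnW nm) // mulr_ge0 ?f_ge0.
suff : \sum_(m <= i < n) a i * f i <= C * f m - (C - \sum_(m <= i < n) a i) * f n.
  by move=> /le_trans; apply; rewrite gerBl mulr_ge0 ?subr_ge0 ?f_ge0 ?partial_le.
rewrite -(subnKC mn); elim: (n - m)%N => [|d IHd].
  by rewrite addn0 !big_geq // subr0 subrr.
rewrite addnS !big_nat_recr ?leq_addr //=; apply: le_trans (lerD IHd (lexx _)) _.
set A := \sum_(_ <= i < _) a i; set k := (m + d)%N.
have -> : C * f m - (C - A) * f k + a k * f k = C * f m - (C - (A + a k)) * f k by ring.
rewrite lerD2l lerN2 ler_wpM2l ?f_decr ?leq_addr // subr_ge0 /A -big_nat_recr ?leq_addr //.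
by rewrite partial_le // leqW ?leq_addr.
Qed.

Lemma ler_norm_sum_abel (R : realDomainType) (a f : nat -> R) m n C :
  (forall k, (m <= k)%N -> `|\sum_(m <= i < k) a i| <= C) ->
  (forall k, (m <= k)%N -> 0 <= f k) -> (forall k, (m <= k)%N -> f k.+1 <= f k) ->
  `|\sum_(m <= i < n) a i * f i| <= C * f m.
Proof.
move=> partial_le f_ge0 f_decr; apply/ler_normlP; split; last first.
  by apply: ler_sum_abel => // k /partial_le /ler_normlP[].
rewrite -sumrN; under eq_bigr do rewrite -mulNr.
by apply: ler_sum_abel => // k /partial_le /ler_normlP[]; rewrite sumrN.
Qed.

Lemma big_nat_prime_ge2 (T : Type) (idx : T) (op : Monoid.law idx) n (F : nat -> T) :
  \big[op/idx]_(0 <= p < n | prime p) F p = \big[op/idx]_(2 <= p < n | prime p) F p.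
Proof.
rewrite [RHS](big_nat_widenl 2 0) //; apply: eq_bigl => p.
by case: (boolP (prime p)) => // /prime_gt1 ->.
Qed.

Section PrimeSums.
Variable R : realType.
Implicit Types (n p : nat) (x : R).

Definition chebyshev_theta n : R := \sum_(0 <= p < n | prime p) ln p%:R.
Definition prime_log_harmonic n : R := \sum_(0 <= p < n | prime p) ln p%:R / p%:R.
Definition prime_harmonic n : R := \sum_(0 <= p < n | prime p) p%:R^-1.

Lemma chebyshev_theta_le n : chebyshev_theta n <= n%:R * ln 4.
Proof.
have ln4_ge0 : 0 <= ln 4 :> R by apply: ln_ge0; lra.
case: n => [|n]; first by rewrite /chebyshev_theta big_geq // mul0r.
apply: (@le_trans _ _ (n%:R * ln 4)); last by rewrite ler_wpM2r // ler_nat.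
rewrite /chebyshev_theta -ln_prod => [|p /prime_gt0]; last by rewrite ltr0n.
rewrite mulr_natl -lnXn // ?ltr0n // -natr_prod -natrX ler_ln ?posrE ?ltr0n ?expn_gt0 //.
  by rewrite ler_nat primorial_le.
by apply: prodn_cond_gt0 => p /prime_gt0.
Qed.

Lemma ln_div_mulD1_le x : 1 <= x ->
  ln (x + 1) / ((x + 1) * x) <= (ln x + 2) / x - (ln (x + 1) + 2) / (x + 1).
Proof.
move=> x_ge1; rewrite -subr_ge0.
have -> : (ln x + 2) / x - (ln (x + 1) + 2) / (x + 1) - ln (x + 1) / ((x + 1) * x)
  = (2 - (x + 1) * (ln (x + 1) - ln x)) / (x * (x + 1)) by field; lra.
rewrite divr_ge0 ?mulr_ge0 ?subr_ge0 //; try lra.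
have lnB_le : ln (x + 1) - ln x <= (x + 1 - x) / x by apply: ler_lnB; lra.
apply: le_trans (ler_wpM2l _ lnB_le) _; first lra.
by rewrite addrAC subrr add0r mul1r ler_pdivrMr; lra.
Qed.

Lemma sum_ln_div_mul_pred_le n : \sum_(2 <= k < n) ln k%:R / (k%:R * k.-1%:R) <= 2 :> R.
Proof.
pose f k : R := (ln k%:R + 2) / k%:R.
have f_ge0 k : 0 <= f k.
  by case: k => [|k]; rewrite /f ?invr0 ?mulr0 // divr_ge0 // addr_ge0 // ln_nat_ge0.
have [n_le2|n_gt2] := leqP n 2; first by rewrite big_geq.
rewrite big_add1; apply: (@le_trans _ _ (\sum_(1 <= k < n.-1) (- f k.+1 - - f k))).
  apply: ler_sum_nat => k /andP[k_gt0 _] /=; rewrite /f -natr1 opprK [leRHS]addrC.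
  by apply: ln_div_mulD1_le; rewrite ler1n.
rewrite (telescope_sumr (fun k => - f k)) ?opprK; last lia.
by rewrite {2}/f ln1 add0r divr1; have := f_ge0 n.-1; lra.
Qed.

Lemma prime_log_harmonicS_le n : (0 < n)%N -> prime_log_harmonic n.+1 <= ln n%:R + 2 * ln 4.
Proof.
move=> n_gt0; have N_gt0 : 0 < n%:R :> R by rewrite ltr0n.
have ln4_ge0 : 0 <= ln 4 :> R by apply: ln_ge0; lra.
have chebyshev_theta_leS : chebyshev_theta n.+1 <= n%:R * (2 * ln 4).
  apply: le_trans (chebyshev_theta_le _) _; rewrite mulrA ler_wpM2r // -natrM ler_nat; lia.
rewrite -(ler_pM2l N_gt0) mulrDr; apply: le_trans (lerD (ln_fact_le R n) chebyshev_theta_leS).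
rewrite ln_fact mulr_sumr -big_split /=; apply: ler_sum => p p_prime.
rewrite mulrA mulrAC -[X in _ + X]mul1r -mulrDl ler_wpM2r ?ln_nat_ge0 //.
rewrite ler_pdivrMr ?ltr0n ?prime_gt0 // natr1 -natrM ler_nat.
have := ltn_ceil n (prime_gt0 p_prime); have := logn_fact_ge n p_prime; nia.
Qed.

Lemma prime_log_harmonicS_ge n : (0 < n)%N -> ln n%:R - 3 <= prime_log_harmonic n.+1.
Proof.
move=> n_gt0; have N_gt0 : 0 < n%:R :> R by rewrite ltr0n.
suff : ln n`!%:R <= n%:R * (prime_log_harmonic n.+1 + 2).
  by have := ln_fact_ge R n; nra.
pose error p : R := ln p%:R / (p%:R * p.-1%:R).
have sum_error_le : \sum_(0 <= p < n.+1 | prime p) error p <= 2.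
  apply: le_trans (sum_ln_div_mul_pred_le n.+1); apply: ler_sum_nat_subset => p.
    by move=> /andP[_ ->] /prime_gt1 ->.
  by rewrite /error divr_ge0 ?mulr_ge0 // ln_nat_ge0.
apply: (@le_trans _ _ (n%:R * \sum_(0 <= p < n.+1 | prime p) (ln p%:R / p%:R + error p)));
  last first.
  by rewrite ler_pM2l // big_split lerD2l.
rewrite ln_fact mulr_sumr; apply: ler_sum => p p_prime.
have p1_gt0 : 0 < p.-1%:R :> R by rewrite ltr0n; have := prime_gt1 p_prime; lia.
have def_p : p%:R = p.-1%:R + 1 :> R by rewrite natr1 prednK ?prime_gt0.
have -> : n%:R * (ln p%:R / p%:R + error p) = n%:R / p.-1%:R * ln p%:R.
  rewrite /error def_p; field; lra.
by rewrite ler_wpM2r ?ln_nat_ge0 // ler_pdivlMr // -natrM ler_nat mulnC logn_fact_le.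
Qed.

Lemma prime_log_harmonic_mertens n : (0 < n)%N -> `|prime_log_harmonic n - ln n%:R| <= 4.
Proof.
move=> n_gt0; have [n_le1|n_gt1] := leqP n 1.
  have -> : n = 1%N by lia.
  by rewrite /prime_log_harmonic ln1 subr0 big_mkcond big_nat1 normr0.
case: n n_gt1 {n_gt0} => // n n_gt0.
have lnS_ge : ln n%:R <= ln n.+1%:R :> R by rewrite ler_ln ?posrE ?ltr0n // ler_nat.
have lnS_le := ln_natS_le R n_gt0.
have ln4_le : ln 4 <= 2 :> R.
  have -> : 4 = 2 * 2 :> R by ring.
  by have := ln2_bounds R; rewrite lnM ?posrE //; lra.
have := prime_log_harmonicS_ge n_gt0; have := prime_log_harmonicS_le n_gt0.
by rewrite ler_norml; lra.
Qed.

Lemma norm_sum_lnB_div_ln_le n : (2 <= n)%N ->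
  `|\sum_(2 <= k < n) (ln k.+1%:R - ln k%:R) / ln k%:R - (ln (ln n%:R) - ln (ln 2))|
    <= (ln 2)^-1 :> R.
Proof.
move=> n_ge2; pose L k : R := ln k%:R.
have L_gt0 k : (2 <= k)%N -> 0 < L k by move=> k_ge2; rewrite ln_gt0 // ltr1n.
have telescope_lnln := telescope_sumr (fun k => ln (L k)) n_ge2.
rewrite -[ln n%:R]/(L n) -[ln 2]/(L 2%N) -telescope_lnln -sumrB ger0_norm; last first.
  rewrite big_nat; apply: sumr_ge0 => k /andP[k_ge2 _].
  by rewrite subr_ge0 ler_lnB ?L_gt0 // leqW.
apply: (@le_trans _ _ (\sum_(2 <= k < n) (- (L k.+1)^-1 - - (L k)^-1))); last first.
  by rewrite (telescope_sumr (fun k => - (L k)^-1)) // opprK gerDr oppr_le0 invr_ge0 ltW ?L_gt0.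
apply: ler_sum_nat => k /andP[k_ge2 _]; rewrite -!/(L _).
have u_gt0 := L_gt0 k k_ge2; have v_gt0 := L_gt0 k.+1 (leqW k_ge2).
have v_le : L k.+1 <= L k + 1 by apply: ln_natS_le; rewrite ltnW.
have u_le : L k <= L k.+1 by rewrite ler_ln ?posrE ?ltr0n ?ler_nat // ltnW.
apply: le_trans (lerB (lexx _) (ger_lnB u_gt0 v_gt0)) _.
rewrite -mulrBr opprK [leRHS]addrC -[leRHS]mul1r ler_wpM2r //; last by lra.
by rewrite subr_ge0 lef_pV2 ?posrE.
Qed.

Lemma prime_harmonic_mertens :
  exists C, forall n, (2 <= n)%N -> `|prime_harmonic n - ln (ln n%:R)| <= C.
Proof.
have ln2_gt0 : 0 < ln 2 :> R by rewrite ln_gt0 // ltr1n.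
exists (5 * (ln 2)^-1 + (ln 2)^-1 + `|ln (ln 2)|) => n n_ge2.
pose excess k : R := (if prime k then ln k%:R / k%:R else 0) - (ln k.+1%:R - ln k%:R).
have sum_excess k : (2 <= k)%N -> `|\sum_(2 <= i < k) excess i| <= 5.
  move=> k_ge2; rewrite sumrB telescope_sumr // -big_mkcond -big_nat_prime_ge2.
  have := prime_log_harmonic_mertens (ltnW k_ge2); have := ln2_bounds R; rewrite !ler_norml.
  rewrite -/(prime_log_harmonic k); lra.
have : `|\sum_(2 <= k < n) excess k * (ln k%:R)^-1| <= 5 * (ln 2)^-1.
  apply: ler_norm_sum_abel => // k k_ge2; first by rewrite invr_ge0 ln_nat_ge0.
  have lnS_ge := ln_nat_ge_ln2 R (leqW k_ge2); have ln_ge := ln_nat_ge_ln2 R k_ge2.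
  by rewrite lef_pV2 ?posrE ?ler_ln ?posrE ?ltr0n ?ler_nat //; lra || lia.
have -> : \sum_(2 <= k < n) excess k * (ln k%:R)^-1 =
    prime_harmonic n - \sum_(2 <= k < n) (ln k.+1%:R - ln k%:R) / ln k%:R.
  rewrite /prime_harmonic big_nat_prime_ge2 [X in _ = X - _]big_mkcond -sumrB.
  apply: eq_big_nat => k /andP[k_ge2 _]; rewrite /excess mulrBl; congr (_ - _).
  case: ifP => k_prime; rewrite ?mul0r // mulrAC mulfV ?mul1r //.
  exact/lt0r_neq0/ln_prime_gt0.
have := norm_sum_lnB_div_ln_le n_ge2; have := ler_norm (ln (ln 2) : R).
have := ler_norm (- ln (ln 2) : R); rewrite normrN !ler_norml; lra.
Qed.

End PrimeSums.

(** * Power sums over primes *)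

Section RealPowers.
Variable R : realType.
Implicit Types s t x y : R.

Lemma le0_ger_powR t x y : t <= 0 -> 0 < x <= y -> y `^ t <= x `^ t :> R.
Proof.
move=> t_le0 /andP[x_gt0 x_le]; have y_gt0 := lt_le_trans x_gt0 x_le.
rewrite -[t]opprK !(powRN _ (- t)) lef_pV2 ?posrE ?powR_gt0 //.
by apply: ge0_ler_powR; rewrite ?nnegrE ?oppr_ge0 // ltW.
Qed.

Lemma mulr_powRN s x : 0 < x -> x * x `^ (- s) = x `^ (1 - s).
Proof. by move=> x_gt0; rewrite powRD ?(gt_eqF x_gt0) ?implybT // powRr1 // ltW. Qed.

Lemma powRN_mul_div s x y : 0 < x -> 0 < y ->
  y `^ (- s) * (x / y) `^ (1 - s) = x `^ (1 - s) * y^-1.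
Proof.
move=> x_gt0 y_gt0; rewrite powRM ?invr_ge0 ?ltW // mulrCA; congr (_ * _).
rewrite -powR_inv1 ?ltW // -powRrM -powRD ?(gt_eqF y_gt0) ?implybT //; congr (_ `^ _); ring.
Qed.

Lemma powR_diff_ge s x : 1 < s -> 0 < x ->
  (s - 1) * (x + 1) `^ (- s) <= x `^ (1 - s) - (x + 1) `^ (1 - s).
Proof.
move=> s_gt1 x_gt0; have x1_gt0 : 0 < x + 1 by lra.
have lnB_ge : (x + 1)^-1 <= ln (x + 1) - ln x.
  by have := ger_lnB x_gt0 x1_gt0; rewrite addrAC subrr add0r mul1r.
have -> : x `^ (1 - s) = (x + 1) `^ (1 - s) * expR ((s - 1) * (ln (x + 1) - ln x)).
  by rewrite /powR !gt_eqF // -expRD; congr expR; ring.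
have := expR_ge1Dx ((s - 1) * (ln (x + 1) - ln x)).
have : (s - 1) * (x + 1)^-1 <= (s - 1) * (ln (x + 1) - ln x) by rewrite ler_wpM2l // subr_ge0 ltW.
have : (x + 1) `^ (- s) = (x + 1) `^ (1 - s) * (x + 1)^-1.
  by rewrite -mulr_powRN // mulrAC mulfV ?mul1r // gt_eqF.
by have := powR_gt0 (1 - s) x1_gt0; nra.
Qed.

Lemma sum_powR_tail_le s n N : 1 < s -> (0 < n)%N ->
  \sum_(n <= k < N) k%:R `^ (- s) <= s / (s - 1) * n%:R `^ (1 - s).
Proof.
move=> s_gt1 n_gt0; have n_pos : 0 < n%:R :> R by rewrite ltr0n.
have [N_le|n_lt] := leqP N n; first by rewrite big_geq // mulr_ge0 ?powR_ge0 // divr_ge0; lra.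
have -> : s / (s - 1) = 1 + (s - 1)^-1 by field; lra.
rewrite big_ltn // mulrDl mul1r lerD //.
  by rewrite ler_powR ?ler1n //; lra.
rewrite big_add1 ler_pdivlMl; last lra; rewrite mulr_sumr.
apply: (@le_trans _ _ (\sum_(n <= k < N.-1) (- k.+1%:R `^ (1 - s) - - k%:R `^ (1 - s)))).
  apply: ler_sum_nat => k /andP[n_le_k _]; rewrite opprK [leRHS]addrC -natr1.
  by rewrite powR_diff_ge // ltr0n (leq_trans n_gt0).
rewrite (telescope_sumr (fun k => - k%:R `^ (1 - s))); last lia.
by rewrite opprK gerDr oppr_le0 powR_ge0.
Qed.

Lemma powR_truncn_le s y : 1 <= s -> 1 <= y ->
  (Num.truncn y)%:R `^ (1 - s) <= 2 `^ (s - 1) * y `^ (1 - s).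
Proof.
move=> s_ge1 y_ge1; have trunc_gt0 : (0 < Num.truncn y)%N by rewrite truncn_gt0.
have y_lt := truncnS_gt y; have : 1 <= (Num.truncn y)%:R :> R by rewrite ler1n.
move: y_lt; rewrite -natr1 => y_lt trunc_ge1.
have -> : 2 `^ (s - 1) * y `^ (1 - s) = (y / 2) `^ (1 - s) :> R.
  rewrite powRM ?invr_ge0; [|lra..].
  by rewrite mulrC -(powR_inv1 (ler0n R 2)) -powRrM; congr (_ * _ `^ _); ring.
by apply: le0_ger_powR; lra.
Qed.

Lemma ler_sum_tail_truncn s C (P : pred nat) (F : nat -> R) : 1 <= s -> 0 <= C ->
  (forall k, P k -> 0 <= F k) ->
  (forall n N, (0 < n)%N -> \sum_(n <= k < N | P k) F k <= C * n%:R `^ (1 - s)) ->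
  forall y N, 1 <= y ->
    \sum_(0 <= k < N | P k && (y <= k%:R)) F k <= C * 2 `^ (s - 1) * y `^ (1 - s).
Proof.
move=> s_ge1 C_ge0 F_ge0 tail_le y N y_ge1.
apply: (@le_trans _ _ (\sum_(Num.truncn y <= k < N | P k) F k)).
  apply: ler_sum_nat_subset => [k /andP[_ ->] /andP[-> y_le]|k _ /F_ge0//].
  by rewrite -(ler_nat R) !andbT (le_trans _ y_le) // truncn_le; lra.
apply: le_trans (tail_le _ _ _) _; first by rewrite truncn_gt0.
by rewrite -mulrA ler_wpM2l // powR_truncn_le.
Qed.

Lemma sum_powR_real_tail_le s : 1 < s -> exists2 C, 0 < C &
  forall y N, 1 <= y -> \sum_(0 <= k < N | y <= k%:R) k%:R `^ (- s) <= C * y `^ (1 - s).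
Proof.
move=> s_gt1; have C_gt0 : 0 < s / (s - 1) by rewrite divr_gt0; lra.
exists (s / (s - 1) * 2 `^ (s - 1)); first by rewrite mulr_gt0 ?powR_gt0.
apply: (@ler_sum_tail_truncn _ _ xpredT) => [||k _|n N]; [exact: ltW..|exact: powR_ge0|].
exact: sum_powR_tail_le.
Qed.

Lemma sum_prime_ln_powR_tail_le s n N : 1 < s -> (0 < n)%N ->
  \sum_(n <= p < N | prime p) ln p%:R * p%:R `^ (- s)
    <= ln 4 * (1 + s / (s - 1)) * n%:R `^ (1 - s).
Proof.
move=> s_gt1 n_gt0; have n_pos : 0 < n%:R :> R by rewrite ltr0n.
have ln4_ge0 : 0 <= ln 4 :> R by apply: ln_ge0; lra.
pose excess k : R := (if prime k then ln k%:R else 0) - ln 4.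
have sum_excess k : (n <= k)%N -> \sum_(n <= i < k) excess i <= n%:R * ln 4.
  move=> n_le; rewrite sumrB sumr_const_nat -big_mkcond lerBlDr.
  rewrite -[ln 4 *+ _]mulr_natl -mulrDl -natrD subnKC //.
  apply: le_trans (chebyshev_theta_le R k); apply: ler_sum_nat_subset => i.
    by move=> /andP[_ ->].
  by rewrite ln_nat_ge0.
have : \sum_(n <= k < N) excess k * k%:R `^ (- s) <= n%:R * ln 4 * n%:R `^ (- s).
  apply: ler_sum_abel => [//|k _|k n_le]; first exact: powR_ge0.
  by apply: le0_ger_powR; [lra | rewrite ltr0n (leq_trans n_gt0) ?ler_nat ?leqnSn].
have -> : \sum_(n <= k < N) excess k * k%:R `^ (- s) =
    \sum_(n <= p < N | prime p) ln p%:R * p%:R `^ (- s) - ln 4 * \sum_(n <= k < N) k%:R `^ (- s).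
  rewrite mulr_sumr [X in _ = X - _]big_mkcond -sumrB; apply: eq_bigr => k _.
  by rewrite /excess mulrBl; case: ifP; rewrite ?mul0r.
rewrite mulrAC mulr_powRN // lerBlDr => /le_trans; apply.
have := ler_wpM2l ln4_ge0 (sum_powR_tail_le N s_gt1 n_gt0); lra.
Qed.

Lemma sum_prime_ln_powR_real_tail_le s : 1 < s -> exists2 C, 0 < C & forall y N, 1 <= y ->
  \sum_(0 <= p < N | prime p && (y <= p%:R)) ln p%:R * p%:R `^ (- s) <= C * y `^ (1 - s).
Proof.
move=> s_gt1; have ln4_gt0 : 0 < ln 4 :> R by apply: ln_gt0; lra.
have C_gt0 : 0 < ln 4 * (1 + s / (s - 1)) by rewrite mulr_gt0 // addr_gt0 // divr_gt0; lra.
exists (ln 4 * (1 + s / (s - 1)) * 2 `^ (s - 1)); first by rewrite mulr_gt0 ?powR_gt0.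
apply: ler_sum_tail_truncn => [||p _|n N]; rewrite ?(ltW s_gt1) ?(ltW C_gt0) //.
  by rewrite mulr_ge0 ?ln_nat_ge0 ?powR_ge0.
exact: sum_prime_ln_powR_tail_le.
Qed.

End RealPowers.

Section PrimesInIntervals.
Variable R : realType.
Implicit Types s x y : R.

(* Mertens' estimate has error at most 4 at both ends, so [ln A >= 9] suffices. *)
Lemma sum_ln_prime_interval_ge1 : exists2 A, (0 < A)%N &
  forall n, (0 < n)%N -> 1 <= \sum_(n <= p < A * n | prime p) ln p%:R / p%:R :> R.
Proof.
exists (Num.truncn (expR 9 : R)).+1 => // n n_gt0; set A := (_).+1.
have lnA_ge : 9 <= ln A%:R :> R.
  by rewrite -[leLHS]expRK ler_ln ?posrE ?expR_gt0 ?ltr0n // ltW // truncnS_gt.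
have An_gt0 : (0 < A * n)%N by rewrite muln_gt0.
have n_le_An : (n <= A * n)%N by exact: leq_pmull.
have := prime_log_harmonic_mertens R An_gt0; have := prime_log_harmonic_mertens R n_gt0.
rewrite [prime_log_harmonic R (A * n)]/prime_log_harmonic (big_cat_nat _ n_le_An) //=.
rewrite -/(prime_log_harmonic R n).
by rewrite natrM lnM ?posrE ?ltr0n // !ler_norml; lra.
Qed.

Lemma powR_prime_ge s x p : 1 <= s -> prime p -> p%:R <= x ->
  x `^ (1 - s) / ln x * (ln p%:R / p%:R) <= p%:R `^ (- s).
Proof.
move=> s_ge1 p_prime p_le; have p_gt0 : 0 < p%:R :> R by rewrite ltr0n prime_gt0.
have lnp_gt0 := ln_prime_gt0 R p_prime.
have lnp_le : ln p%:R <= ln x by rewrite ler_ln ?posrE //; lra.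
have -> : p%:R `^ (- s) = p%:R `^ (1 - s) / ln p%:R * (ln p%:R / p%:R).
  by rewrite -mulr_powRN //; field; lra.
rewrite ler_wpM2r ?divr_ge0 ?ln_nat_ge0 // ler_pM ?powR_ge0 ?invr_ge0 //; first lra.
  by apply: le0_ger_powR; lra.
by rewrite lef_pV2 ?posrE //; lra.
Qed.

Lemma sum_prime_powR_interval_ge s : 1 <= s -> exists2 A, (0 < A)%N &
  forall n x, (0 < n)%N -> 1 < x -> (A * n)%:R <= x ->
    x `^ (1 - s) / ln x <= \sum_(n <= p < A * n | prime p) p%:R `^ (- s).
Proof.
move=> s_ge1; have [A A_gt0 sum_ge1] := sum_ln_prime_interval_ge1.
exists A => // n x n_gt0 x_gt1 An_le; set c := _ / _.
have c_ge0 : 0 <= c by rewrite divr_ge0 ?powR_ge0 // ln_ge0 // ltW.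
apply: (@le_trans _ _ (c * \sum_(n <= p < A * n | prime p) ln p%:R / p%:R)).
  by rewrite ler_peMr ?sum_ge1.
rewrite mulr_sumr big_nat_cond [leRHS]big_nat_cond.
apply: ler_sum => p /andP[/andP[_ p_lt] p_prime]; apply: powR_prime_ge => //.
by apply: le_trans An_le; rewrite ler_nat ltnW.
Qed.

Lemma sum_prime_powR_tail_ge s : 1 <= s -> exists2 c, 0 < c & exists2 B : R, 1 < B &
  forall y N, B <= y -> B * y <= N%:R ->
    c * (y `^ (1 - s) / ln y) <= \sum_(0 <= p < N | prime p && (y <= p%:R)) p%:R `^ (- s).
Proof.
move=> s_ge1; have [A A_gt0 sum_ge] := sum_prime_powR_interval_ge s_ge1.
have A_ge1 : 1 <= A%:R :> R by rewrite ler1n.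
set B : R := 2 * A%:R; have B_ge2 : 2 <= B by rewrite /B; lra.
exists (B `^ (1 - s) / 2); first by rewrite divr_gt0 ?powR_gt0 //; lra.
exists B => [|y N B_le_y By_le_N]; first lra.
have y_gt1 : 1 < y by lra.
have lny_gt0 := ln_gt0 y_gt1.
pose n := (Num.truncn y).+1; have y_lt_n : y < n%:R by exact: truncnS_gt.
have An_le : (A * n)%:R <= B * y.
  have trunc_le : (Num.truncn y)%:R <= y by rewrite truncn_le; lra.
  by rewrite natrM /B [leRHS]mulrAC [leRHS]mulrC ler_wpM2l // /n -natr1; lra.
apply: (@le_trans _ _ ((B * y) `^ (1 - s) / ln (B * y))).
  rewrite mulrACA -invfM -powRM; [|lra..].
  have lnBy_le : ln (B * y) <= 2 * ln y.
    by rewrite lnM ?posrE ?mulr_natl ?mulr2n ?lerD2r ?ler_ln ?posrE //; lra.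
  rewrite ler_wpM2l ?powR_ge0 // lef_pV2 ?posrE ?mulr_gt0 // ln_gt0 //; nra.
apply: (@le_trans _ _ (\sum_(n <= p < A * n | prime p) p%:R `^ (- s))).
  by apply: sum_ge => //; nra.
apply: ler_sum_nat_subset => [p /andP[n_le_p p_lt] ->|p _ _]; last exact: powR_ge0.
rewrite (le_trans (ltW y_lt_n)) ?ler_nat // andbT -(ltr_nat R) (lt_le_trans _ By_le_N) //.
by rewrite (lt_le_trans _ An_le) // ltr_nat.
Qed.

End PrimesInIntervals.

(** * Double counting of factorisations *)

Lemma bigomega_sum_logn n K : (n < K)%N ->
  bigomega n = (\sum_(0 <= p < K | prime p) logn p n)%N.
Proof.
case: n => [|n] n_lt_K; first by rewrite /bigomega big_nil big1 // => p _; rewrite logn0.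
rewrite /bigomega (big_primes_range _ (K := K)) // => [|p _ /dvdn_leq p_le]; last first.
  by rewrite (leq_ltn_trans (p_le _)).
rewrite big_mkcondr; apply: eq_bigr => p p_prime; case: ifPn => // p_ndvd.
by apply/esym/eqP; rewrite -leqn0 leqNgt logn_gt0 mem_primes p_prime (negbTE p_ndvd).
Qed.

Lemma bigomega_primeM p m : prime p -> (0 < m)%N -> bigomega (p * m) = (bigomega m).+1.
Proof.
move=> p_prime m_gt0; have p_gt0 := prime_gt0 p_prime.
rewrite !(@bigomega_sum_logn _ (p * m).+1) ?ltnS ?leq_pmull //.
under eq_bigr => q _ do rewrite lognM // logn_prime //.
rewrite big_split /= -[RHS]add1n; congr addn.
rewrite big_mkcond (bigD1_seq p) ?iota_uniq //=; last by rewrite mem_index_iota ltnS leq_pmulr.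
by rewrite p_prime eqxx big1 // => q /negbTE ->; case: ifP.
Qed.

Lemma almost_prime_primeM l p m : prime p -> almost_prime l.+1 (p * m) = almost_prime l m.
Proof.
move=> p_prime; case: m => [|m]; first by rewrite muln0.
by rewrite /almost_prime bigomega_primeM // muln_gt0 prime_gt0.
Qed.

Lemma size_primes_le_bigomega n : (size (primes n) <= bigomega n)%N.
Proof.
rewrite /bigomega -sum1_size big_seq [leqRHS]big_seq.
by apply: leq_sum => p; rewrite logn_gt0.
Qed.

Lemma size_primes_gt0 n : (1 < n)%N -> (0 < size (primes n))%N.
Proof.
move=> n_gt1; have : pdiv n \in primes n by rewrite mem_primes pdiv_prime // pdiv_dvd ltnW.
by case: (primes n).
Qed.

Lemma almost_prime0 n : almost_prime 0 n = (n == 1)%N.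
Proof.
case: n => [|[|n]] //; first by rewrite /almost_prime /bigomega big_nil.
apply: contraTF (@size_primes_gt0 n.+2 isT) => /andP[_].
by rewrite leqn0 => /eqP bigomega0; rewrite -leqNgt -bigomega0 size_primes_le_bigomega.
Qed.

Lemma ln_le_bigomega (R : realType) n :
  ln n%:R <= (bigomega n)%:R * \sum_(p <- primes n) ln p%:R :> R.
Proof.
case: n => [|n]; first by rewrite big_nil mulr0 ln0.
rewrite ln_nat_prime_decomp // mulr_sumr big_seq [leRHS]big_seq.
apply: ler_sum => p p_n; rewrite ler_wpM2r ?ln_nat_ge0 // ler_nat.
by rewrite /bigomega (bigD1_seq p) ?primes_uniq //= leq_addr.
Qed.

Section DoubleCounting.
Variables (T : Type) (idx : T) (op : Monoid.com_law idx).

Lemma big_dvdn_reindex p K (P : pred nat) (F : nat -> T) : (0 < p)%N ->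
  \big[op/idx]_(0 <= k < K | P k && (p %| k)%N) F k =
  \big[op/idx]_(0 <= m < K | (p * m < K)%N && P (p * m)%N) F (p * m)%N.
Proof.
move=> p_gt0; rewrite -[LHS]big_filter -[RHS]big_filter.
rewrite -(big_map (muln p) xpredT F); apply/perm_big/uniq_perm.
- exact/filter_uniq/iota_uniq.
- rewrite map_inj_uniq; first exact/filter_uniq/iota_uniq.
  by move=> m n /eqP; rewrite eqn_pmul2l // => /eqP.
move=> k; rewrite mem_filter mem_index_iota; apply/idP/mapP.
  move=> /andP[/andP[Pk /dvdnP[m def_k]] /andP[_ k_lt]].
  exists m; rewrite 1?mulnC // mem_filter mem_index_iota mulnC -def_k Pk k_lt /=; nia.
move=> [m]; rewrite mem_filter mem_index_iota => /andP[/andP[pm_lt Ppm] _] ->.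
by rewrite Ppm dvdn_mulr.
Qed.

Lemma exchange_big_primes K (P : pred nat) (H : nat -> nat -> T) :
  \big[op/idx]_(0 <= k < K | P k) \big[op/idx]_(p <- primes k) H p k =
  \big[op/idx]_(0 <= p < K | prime p)
    \big[op/idx]_(0 <= m < K | (p * m < K)%N && ((0 < m)%N && P (p * m)%N)) H p (p * m)%N.
Proof.
transitivity (\big[op/idx]_(0 <= k < K | P k)
    \big[op/idx]_(0 <= p < K | prime p && ((0 < k)%N && (p %| k)%N)) H p k).
  rewrite big_nat_cond [RHS]big_nat_cond; apply: eq_bigr => -[|k] /andP[/andP[_ k_lt] _].
    by rewrite big_nil big_pred0 // => p; rewrite andbF.
  by apply: big_primes_range => // p _ /dvdn_leq p_le; rewrite (leq_ltn_trans (p_le _)).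
rewrite (exchange_big_dep prime) /= => [|k p _ /andP[]//]; apply: eq_bigr => p p_prime.
rewrite p_prime /=.
under eq_bigl => k do rewrite andbA.
rewrite big_dvdn_reindex ?prime_gt0 //.
by apply: eq_bigl => m; rewrite muln_gt0 prime_gt0 //= [P _ && _]andbC.
Qed.

End DoubleCounting.

Section AlmostPrimeDoubleCounting.
Variables (R : numDomainType) (w g : nat -> R).
Hypothesis w_ge0 : forall p, 0 <= w p.
Hypothesis g_ge0 : forall n, 0 <= g n.
Hypothesis gM : {morph g : m n / (m * n)%N >-> m * n}.
Implicit Type P : pred nat.

Lemma exchange_sum_almost_prime_primes l K P :
  \sum_(0 <= k < K | almost_prime l.+1 k && P k) g k * \sum_(p <- primes k) w p =
  \sum_(0 <= p < K | prime p) \sum_(0 <= m < K | (p * m < K)%N && (almost_prime l m && P (p * m)%N))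
    g m * (w p * g p).
Proof.
under eq_bigr do rewrite mulr_sumr.
rewrite exchange_big_primes; apply: eq_bigr => p p_prime; apply: eq_big => [m|m _].
  by rewrite almost_prime_primeM //; case: m.
by rewrite gM mulrAC mulrC [w p * _]mulrC.
Qed.

Lemma exchange_sum_almost_prime_primes_le l K P :
  \sum_(0 <= k < K | almost_prime l.+1 k && P k) g k * \sum_(p <- primes k) w p <=
  \sum_(0 <= m < K | almost_prime l m)
    g m * \sum_(0 <= p < K | prime p && P (p * m)%N) w p * g p.
Proof.
rewrite exchange_sum_almost_prime_primes; under [leRHS]eq_bigr do rewrite mulr_sumr.
rewrite [leRHS](exchange_big_dep prime) => [|m p _ /andP[]//]; apply: ler_sum => p p_prime.
apply: ler_sum_nat_subset => m m_range; last by rewrite !mulr_ge0.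
by move=> /andP[_ /andP[-> ->]]; rewrite m_range p_prime.
Qed.

Lemma exchange_sum_almost_prime_primes_ge l K M N P : (N * M <= K)%N ->
  \sum_(0 <= m < M | almost_prime l m)
    g m * \sum_(0 <= p < N | prime p && P (p * m)%N) w p * g p <=
  \sum_(0 <= k < K | almost_prime l.+1 k && P k) g k * \sum_(p <- primes k) w p.
Proof.
move=> NM_le_K; rewrite exchange_sum_almost_prime_primes; under eq_bigr do rewrite mulr_sumr.
have wg_ge0 p m : 0 <= g m * (w p * g p) by rewrite !mulr_ge0.
have [->|M_gt0] := posnP M.
  by rewrite big_geq //; apply: sumr_ge0 => p _; apply: sumr_ge0 => m _.
rewrite (exchange_big_dep prime) => [|m p _ /andP[]//].
apply: (@le_trans _ _ (\sum_(0 <= p < N | prime p)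
    \sum_(0 <= m < K | (p * m < K)%N && (almost_prime l m && P (p * m)%N)) g m * (w p * g p))).
  rewrite big_nat_cond [leRHS]big_nat_cond; apply: ler_sum => p /andP[/andP[_ p_lt] p_prime].
  apply: ler_sum_nat_subset => m; last by [].
  by move=> /andP[_ m_lt] /andP[-> /andP[_ ->]]; have := prime_gt0 p_prime; rewrite !andbT; nia.
apply: ler_sum_nat_subset => [p /andP[_ p_lt] ->|p _ _]; last exact: sumr_ge0.
by rewrite andbT; nia.
Qed.

End AlmostPrimeDoubleCounting.

Lemma sumr1_size (R : nzSemiRingType) (T : Type) (r : seq T) : \sum_(i <- r) 1 = (size r)%:R :> R.
Proof. by rewrite -sum1_size natr_sum. Qed.

Lemma sum_almost_primeS_ge (R : numDomainType) (g : nat -> R) l K M N (P : pred nat) :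
  (forall n, 0 <= g n) -> {morph g : m n / (m * n)%N >-> m * n} -> (N * M <= K)%N ->
  \sum_(0 <= m < M | almost_prime l m) g m * \sum_(0 <= p < N | prime p && P (p * m)%N) g p <=
  l.+1%:R * \sum_(0 <= k < K | almost_prime l.+1 k && P k) g k.
Proof.
move=> g_ge0 gM NM_le_K.
have := @exchange_sum_almost_prime_primes_ge R (fun=> 1) g (fun=> ler01) g_ge0 gM l K M N P.
move=> /(_ NM_le_K) /=.
under eq_bigr do under eq_bigr do rewrite mul1r.
move=> /le_trans; apply; rewrite mulr_sumr; apply: ler_sum => k /andP[/andP[_ Omega_le] _].
rewrite mulrC ler_wpM2r // sumr1_size ler_nat.
exact: leq_trans (size_primes_le_bigomega k) Omega_le.
Qed.

(** * Reciprocal sums of almost primes *)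

Section IteratedLogarithm.
Variable R : realType.
Implicit Types (c x : R).

Lemma near_ln_ln_ge c : \forall x \near +oo, c <= ln (ln x).
Proof.
near=> x; have x_ge : expR (expR c) <= x by near: x; exact: nbhs_pinfty_ge.
have x_gt0 := lt_le_trans (expR_gt0 _) x_ge.
have lnx_ge : expR c <= ln x by rewrite -[leLHS]expRK ler_ln ?posrE ?expR_gt0.
by rewrite -[leLHS]expRK ler_ln ?posrE ?expR_gt0 // (lt_le_trans (expR_gt0 _) lnx_ge).
Unshelve. all: by end_near. Qed.

Lemma near_ln_ln_nat_ge c : \forall n \near \oo, c <= ln (ln n%:R).
Proof. exact: cvgr_idn (near_ln_ln_ge c). Qed.

Lemma cvg_truncn_sqrt : Num.truncn (Num.sqrt x) @[x --> (+oo : set_system R)] --> \oo.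
Proof.
apply/cvgnyPge => n; near=> x.
have x_ge : n%:R ^+ 2 <= x by near: x; exact: nbhs_pinfty_ge.
by rewrite truncn_ge_nat ?sqrtr_ge0 // -[leLHS]ger0_norm // -sqrtr_sqr ler_wsqrtr.
Unshelve. all: by end_near. Qed.

Lemma truncn_sqrt_sqr_le x : 0 <= x -> (Num.truncn (Num.sqrt x))%:R ^+ 2 <= x.
Proof.
move=> x_ge0; rewrite -[leRHS](sqr_sqrtr x_ge0) lerXn2r ?nnegrE ?sqrtr_ge0 //.
by rewrite truncn_le sqrtr_ge0.
Qed.

Lemma near_ln_ln_truncn_sqrt :
  \forall x \near +oo, ln (ln x) / 2 <= ln (ln (Num.truncn (Num.sqrt x))%:R) :> R.
Proof.
near=> x; set r : R := (Num.truncn _)%:R.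
have r_ge3 : 3 <= r.
  by rewrite ler_nat; near: x; exact: cvg_truncn_sqrt _ (nbhs_infty_ge 3).
have x_gt1 : 1 < x by near: x; exact: nbhs_pinfty_gt.
have lnlnx_ge : 2 * ln 3 <= ln (ln x) by near: x; exact: near_ln_ln_ge.
have x_le : x <= r ^+ 3.
  have := truncnS_gt (Num.sqrt x); rewrite -natr1 -/r => sqrt_lt.
  have := sqr_sqrtr (ltW (lt_trans ltr01 x_gt1)); have := sqrtr_ge0 x; nra.
have lnr_gt0 : 0 < ln r by rewrite ln_gt0 //; lra.
have lnx_gt0 := ln_gt0 x_gt1.
have lnx_le : ln x <= 3 * ln r.
  by rewrite mulr_natl -lnXn ?ler_ln ?posrE ?exprn_gt0 //; lra.
have : ln (ln x) <= ln 3 + ln (ln r) by rewrite -lnM ?posrE ?ler_ln ?posrE ?mulr_gt0.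
lra.
Unshelve. all: by end_near. Qed.

Lemma near_ln_ln_truncnS_le :
  \forall x \near +oo, ln (ln (Num.truncn x).+1%:R) <= 2 * ln (ln x) :> R.
Proof.
near=> x; have x_ge2 : 2 <= x by near: x; exact: nbhs_pinfty_ge.
have lnln_ge1 : 1 <= ln (ln x) by near: x; exact: near_ln_ln_ge.
have lnx_gt0 : 0 < ln x by rewrite ln_gt0 //; lra.
have truncnS_le : (Num.truncn x).+1%:R <= x ^+ 2.
  have : (Num.truncn x)%:R <= x by rewrite truncn_le; lra.
  by rewrite -natr1; nra.
have truncnS_gt1 : 1 < (Num.truncn x).+1%:R :> R by have := truncnS_gt x; lra.
have lnS_le : ln (Num.truncn x).+1%:R <= 2 * ln x.
  by rewrite mulr_natl -lnXn ?ler_ln ?posrE ?exprn_gt0 //; lra.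
have : ln (ln (Num.truncn x).+1%:R) <= ln 2 + ln (ln x).
  by rewrite -lnM ?posrE // ler_ln ?posrE ?mulr_gt0 ?ln_gt0.
have := ln2_bounds R; lra.
Unshelve. all: by end_near. Qed.

End IteratedLogarithm.

Section AlmostPrimeHarmonic.
Variable R : realType.

Definition almost_prime_harmonic l n : R := \sum_(0 <= m < n | almost_prime l m) m%:R^-1.

Let natr_invM : {morph (fun n => n%:R^-1 : R) : m n / (m * n)%N >-> m * n}.
Proof. by move=> m n; rewrite natrM invfM. Qed.

Lemma almost_prime_harmonic_ge0 l n : 0 <= almost_prime_harmonic l n.
Proof. by apply: sumr_ge0 => m _; rewrite invr_ge0. Qed.

Lemma almost_prime_harmonic0 n : almost_prime_harmonic 0 n = (1 < n)%:R.
Proof.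
rewrite /almost_prime_harmonic; under eq_bigl do rewrite almost_prime0.
by rewrite big_nat1_eq invr1; case: ltnP.
Qed.

Lemma almost_prime_harmonicS_le l n :
  almost_prime_harmonic l.+1 n <= 1 + prime_harmonic R n * almost_prime_harmonic l n.
Proof.
have inv_ge0 k : 0 <= k%:R^-1 :> R by rewrite invr_ge0.
have := @exchange_sum_almost_prime_primes_le R (fun=> 1) _ (fun=> ler01) inv_ge0 natr_invM l n.
move=> /(_ xpredT).
under [leRHS]eq_bigr => m _ do [under eq_bigl do rewrite andbT; under eq_bigr do rewrite mul1r].
rewrite -mulr_suml mulrC => /(lerD (lexx 1)); apply: le_trans.
rewrite /almost_prime_harmonic (bigID (pred1 1%N)) /=; apply: lerD.
  apply: (@le_trans _ _ (almost_prime_harmonic 0 n)); last first.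
    by rewrite almost_prime_harmonic0 lern1 leq_b1.
  by apply: ler_sum_nat_subset => // k k_range /andP[_ k_eq1]; rewrite k_range almost_prime0.
apply: (@le_trans _ _ (\sum_(0 <= k < n | almost_prime l.+1 k && (k != 1%N))
    k%:R^-1 * \sum_(p <- primes k) 1)); last first.
  apply: ler_sum_nat_subset => [k k_range /andP[-> _]|k _ _]; first by rewrite k_range.
  by rewrite mulr_ge0 // sumr_ge0.
apply: ler_sum => k /andP[/andP[k_gt0 _] k_neq1]; rewrite ler_peMr //.
rewrite sumr1_size ler1n size_primes_gt0 //; lia.
Qed.

Lemma almost_prime_harmonicS_ge l K M N : (N * M <= K)%N ->
  prime_harmonic R N * almost_prime_harmonic l M <= l.+1%:R * almost_prime_harmonic l.+1 K.
Proof.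
have inv_ge0 k : 0 <= k%:R^-1 :> R by rewrite invr_ge0.
move=> NM_le; have := sum_almost_primeS_ge l xpredT inv_ge0 natr_invM NM_le.
under eq_bigr => m _ do under eq_bigl do rewrite andbT.
by rewrite -mulr_suml mulrC; under [X in l.+1%:R * X]eq_bigl do rewrite andbT.
Qed.

Lemma near_prime_harmonic_le : exists2 C, 0 < C &
  \forall n \near \oo, prime_harmonic R n <= C * ln (ln n%:R).
Proof.
have [C mertens] := prime_harmonic_mertens R.
exists (1 + `|C|) => [|]; first by rewrite ltr_pwDl.
near=> n; have lnln_ge1 : 1 <= ln (ln n%:R) :> R by near: n; exact: near_ln_ln_nat_ge.
have n_ge2 : (2 <= n)%N by near: n; exact: nbhs_infty_ge.
have := mertens n n_ge2; rewrite ler_norml => /andP[_].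
have := ler_norm C; have := normr_ge0 C; nra.
Unshelve. all: by end_near. Qed.

Lemma near_prime_harmonic_ge :
  \forall n \near \oo, ln (ln n%:R) / 2 <= prime_harmonic R n.
Proof.
have [C mertens] := prime_harmonic_mertens R.
near=> n; have lnln_ge : 2 * C <= ln (ln n%:R) :> R by near: n; exact: near_ln_ln_nat_ge.
have n_ge2 : (2 <= n)%N by near: n; exact: nbhs_infty_ge.
have := mertens n n_ge2; rewrite ler_norml; lra.
Unshelve. all: by end_near. Qed.

Lemma near_almost_prime_harmonic_le l : exists2 C, 0 < C &
  \forall n \near \oo, almost_prime_harmonic l n <= C * ln (ln n%:R) ^+ l.
Proof.
have [C C_gt0 prime_le] := near_prime_harmonic_le.
elim: l => [|l [D D_gt0 IHl]].
  exists 1 => //; by near=> n; rewrite expr0 mulr1 almost_prime_harmonic0 lern1 leq_b1.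
exists (1 + C * D); first by rewrite addr_gt0 // mulr_gt0.
near=> n; have lnln_ge1 : 1 <= ln (ln n%:R) :> R by near: n; exact: near_ln_ln_nat_ge.
have lnlnX_ge1 : 1 <= ln (ln n%:R) ^+ l.+1 :> R by exact: exprn_ege1.
have prime_le_n : prime_harmonic R n <= C * ln (ln n%:R) by near: n.
have IHl_n : almost_prime_harmonic l n <= D * ln (ln n%:R) ^+ l by near: n.
have prime_ge0 : 0 <= prime_harmonic R n by apply: sumr_ge0 => p _; rewrite invr_ge0.
apply: le_trans (almost_prime_harmonicS_le _ _) _; rewrite mulrDl mul1r lerD //.
by rewrite exprS mulrACA ler_pM // almost_prime_harmonic_ge0.
Unshelve. all: by end_near. Qed.

Lemma near_almost_prime_harmonic_ge l : exists2 c, 0 < c &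
  \forall n \near \oo, c * ln (ln n%:R) ^+ l <= almost_prime_harmonic l n.
Proof.
elim: l => [|l [c c_gt0 IHl]].
  exists 1 => //; near=> n; rewrite expr0 mulr1 almost_prime_harmonic0.
  by have -> : (1 < n)%N by near: n; exact: nbhs_infty_gt.
pose r n := Num.truncn (Num.sqrt (n%:R : R)).
have cvg_r : r n @[n --> \oo] --> \oo.
  by apply: cvg_comp (@cvg_truncn_sqrt R); exact: cvgr_idn.
exists (c / 2 / 2 ^+ l.+1 / l.+1%:R); first by rewrite !divr_gt0 ?exprn_gt0.
near=> n; rewrite mulrAC ler_pdivrMr ?ltr0n // [leRHS]mulrC.
have r_sqr_le : (r n * r n <= n)%N.
  by rewrite -(ler_nat R) natrM -expr2 truncn_sqrt_sqr_le.
have prime_ge : ln (ln (r n)%:R) / 2 <= prime_harmonic R (r n).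
  by near: n; exact: cvg_r _ near_prime_harmonic_ge.
have IHl_r : c * ln (ln (r n)%:R) ^+ l <= almost_prime_harmonic l (r n).
  by near: n; exact: cvg_r _ IHl.
have lnln_r_ge : ln (ln n%:R) / 2 <= ln (ln (r n)%:R) :> R.
  by near: n; exact: cvgr_idn _ (@near_ln_ln_truncn_sqrt R).
have lnln_ge0 : 0 <= ln (ln n%:R) :> R by near: n; exact: near_ln_ln_nat_ge.
have lnln_r_ge0 : 0 <= ln (ln (r n)%:R) :> R by apply: le_trans lnln_r_ge; rewrite divr_ge0.
apply: le_trans (almost_prime_harmonicS_ge l r_sqr_le).
apply: le_trans (ler_pM _ _ prime_ge IHl_r); rewrite ?divr_ge0 ?mulr_ge0 ?exprn_ge0 ?(ltW c_gt0) //.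
have -> : ln (ln (r n)%:R) / 2 * (c * ln (ln (r n)%:R) ^+ l) = c / 2 * ln (ln (r n)%:R) ^+ l.+1.
  by rewrite exprS; ring.
rewrite -(mulrA (c / 2)) [(2 ^+ _)^-1 * _]mulrC -expr_div_n ler_wpM2l ?divr_ge0 ?(ltW c_gt0) //.
by rewrite lerXn2r ?nnegrE ?divr_ge0.
Unshelve. all: by end_near. Qed.

Lemma near_almost_prime_harmonic_truncnS_le l : exists2 C, 0 < C &
  \forall x \near +oo, almost_prime_harmonic l (Num.truncn x).+1 <= C * ln (ln x) ^+ l.
Proof.
have [C C_gt0 harmonic_le] := near_almost_prime_harmonic_le l.
exists (C * 2 ^+ l); first by rewrite mulr_gt0 ?exprn_gt0.
have truncnS_ge n : \forall x \near (+oo : set_system R), (n <= (Num.truncn x).+1)%N.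
  near=> x; apply/leqW.
  by rewrite truncn_ge_nat; near: x; exact: nbhs_pinfty_ge.
have cvg_truncnS : (Num.truncn x).+1 @[x --> (+oo : set_system R)] --> \oo by exact/cvgnyPge.
near=> x; have lnln_le : ln (ln (Num.truncn x).+1%:R) <= 2 * ln (ln x).
  by near: x; exact: near_ln_ln_truncnS_le.
have lnln_ge0 : 0 <= ln (ln (Num.truncn x).+1%:R) :> R.
  by near: x; exact: cvg_truncnS _ (near_ln_ln_nat_ge 0).
apply: (@le_trans _ _ (C * ln (ln (Num.truncn x).+1%:R) ^+ l)).
  by near: x; exact: cvg_truncnS _ harmonic_le.
by rewrite -mulrA -exprMn ler_pM2l // lerXn2r // nnegrE (le_trans lnln_ge0).
Unshelve. all: by end_near. Qed.

End AlmostPrimeHarmonic.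

(** * Tail sums of almost primes *)

Section AlmostPrimeTail.
Variable R : realType.
Implicit Types (s M : R) (l m n N : nat).

Definition almost_prime_tail l s M N : R :=
  \sum_(0 <= k < N | almost_prime l k && (M <= k%:R)) k%:R `^ (- s).

Definition tail_order l s M : R := ln (ln M) ^+ l * (M `^ (1 - s) / ln M).

Lemma natr_powRM s : {morph (fun n => n%:R `^ s : R) : m n / (m * n)%N >-> m * n}.
Proof. by move=> m n; rewrite natrM powRM. Qed.

Lemma almost_prime_tail_ge s : 1 <= s -> exists2 c, 0 < c & exists B, forall l r M N,
  B <= r%:R -> r%:R ^+ 2 <= M -> B * M <= N%:R ->
  c * (M `^ (1 - s) / ln M) * almost_prime_harmonic R l r
    <= l.+1%:R * almost_prime_tail l.+1 s M (N * r).
Proof.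
move=> s_ge1; have [c c_gt0 [B B_gt1 prime_tail_ge]] := sum_prime_powR_tail_ge s_ge1.
exists c => //; exists B => l r M N B_le_r r2_le_M BM_le_N.
have r_gt1 : 1 < r%:R :> R by lra.
have M_gt1 : 1 < M by nra.
have pow_ge0 n : 0 <= n%:R `^ (- s) :> R by exact: powR_ge0.
apply: le_trans (sum_almost_primeS_ge l (fun k => M <= k%:R) pow_ge0 (@natr_powRM (- s)) (leqnn _)).
rewrite mulr_sumr big_nat_cond [leRHS]big_nat_cond.
apply: ler_sum => m /andP[/andP[_ m_lt_r] /andP[m_gt0 _]].
have m_ge1 : 1 <= m%:R :> R by rewrite ler1n.
have {}m_gt0 : 0 < m%:R :> R by lra.
have {}m_lt_r : m%:R < r%:R :> R by rewrite ltr_nat.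
under [X in _ <= _ * X]eq_bigl => p do rewrite natrM -ler_pdivrMr //.
have r_le_y : r%:R <= M / m%:R by rewrite ler_pdivlMr //; nra.
have y_le_M : M / m%:R <= M by rewrite ler_pdivrMr //; nra.
have := prime_tail_ge (M / m%:R) N; rewrite (le_trans B_le_r r_le_y).
rewrite (le_trans _ BM_le_N) ?ler_wpM2l //; last lra.
move=> /(_ isT isT) /(ler_wpM2l (powR_ge0 m%:R (- s))); apply: le_trans.
have -> : m%:R `^ (- s) * (c * ((M / m%:R) `^ (1 - s) / ln (M / m%:R))) =
    c * (m%:R `^ (- s) * (M / m%:R) `^ (1 - s)) / ln (M / m%:R) by ring.
rewrite (@powRN_mul_div _ s M m%:R) //; last lra.
have -> : c * (M `^ (1 - s) / ln M) / m%:R = c * (M `^ (1 - s) / m%:R) / ln M by ring.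
rewrite ler_wpM2l ?mulr_ge0 ?powR_ge0 ?invr_ge0 ?(ltW c_gt0) ?(ltW m_gt0) //.
have lny_gt0 : 0 < ln (M / m%:R) by apply: ln_gt0; lra.
by rewrite lef_pV2 ?posrE ?ler_ln ?posrE ?ln_gt0 //; lra.
Qed.

Lemma near_almost_prime_tail_ge l s : 1 <= s -> exists2 c, 0 < c &
  \forall M \near +oo, exists N,
    c * tail_order l s M <= almost_prime_tail l.+1 s M N.
Proof.
move=> s_ge1; have [c c_gt0 [B tail_ge]] := almost_prime_tail_ge s_ge1.
have [d d_gt0 harmonic_ge] := near_almost_prime_harmonic_ge R l.
exists (c * (d / 2 ^+ l) / l.+1%:R); first by rewrite !(divr_gt0, mulr_gt0) ?exprn_gt0.
pose r M := Num.truncn (Num.sqrt M); near=> M.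
have M_gt1 : 1 < M by near: M; exact: nbhs_pinfty_gt.
have B_le_r : B <= (r M)%:R by near: M; exact: cvg_truncn_sqrt (nbhs_infty_ger B).
have harmonic_ge_r : d * ln (ln (r M)%:R) ^+ l <= almost_prime_harmonic R l (r M).
  by near: M; exact: cvg_truncn_sqrt harmonic_ge.
have lnln_r_ge : ln (ln M) / 2 <= ln (ln (r M)%:R) by near: M; exact: near_ln_ln_truncn_sqrt.
have lnln_ge0 : 0 <= ln (ln M) by near: M; exact: near_ln_ln_ge.
have r2_le : (r M)%:R ^+ 2 <= M by apply: truncn_sqrt_sqr_le; lra.
pose N := (Num.truncn (B * M)).+1; exists (N * r M)%N.
have := tail_ge l (r M) M N B_le_r r2_le (ltW (truncnS_gt _)).
rewrite [l.+1%:R * _]mulrC -ler_pdivrMr ?ltr0n //; apply: le_trans.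
rewrite mulrAC ler_pM2r ?invr_gt0 ?ltr0n //.
have -> : c * (d / 2 ^+ l) * tail_order l s M =
    c * (M `^ (1 - s) / ln M) * (d * (ln (ln M) / 2) ^+ l).
  by rewrite /tail_order expr_div_n; ring.
rewrite ler_wpM2l ?mulr_ge0 ?powR_ge0 ?invr_ge0 ?ln_ge0 ?(ltW c_gt0) ?(ltW M_gt1) //.
apply: le_trans harmonic_ge_r; rewrite ler_pM2l // lerXn2r ?nnegrE ?divr_ge0 //.
by apply: le_trans lnln_r_ge; rewrite divr_ge0.
Unshelve. all: by end_near. Qed.

Lemma ln_mul_almost_prime_tail_le l s M N : 0 < M ->
  ln M * almost_prime_tail l.+1 s M N <=
  l.+1%:R * \sum_(0 <= m < N | almost_prime l m)
    m%:R `^ (- s) * \sum_(0 <= p < N | prime p && (M <= (p * m)%:R)) ln p%:R * p%:R `^ (- s).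
Proof.
move=> M_gt0; have pow_ge0 k : 0 <= k%:R `^ (- s) :> R by exact: powR_ge0.
have := @exchange_sum_almost_prime_primes_le R _ _ (ln_nat_ge0 R) pow_ge0 (@natr_powRM (- s)) l N.
move=> /(_ (fun k => M <= k%:R)) /(ler_wpM2l (ler0n R l.+1)); apply: le_trans.
rewrite !mulr_sumr; apply: ler_sum => k /andP[/andP[k_gt0 Omega_le] M_le_k].
rewrite [leRHS]mulrCA [leLHS]mulrC ler_wpM2l //.
apply: (@le_trans _ _ (ln k%:R)); first by rewrite ler_ln ?posrE ?ltr0n.
apply: le_trans (ln_le_bigomega R k) _; rewrite ler_wpM2r ?ler_nat //.
by apply: sumr_ge0 => p _; exact: ln_nat_ge0.
Qed.

Lemma powRN_mul_prime_tail_le s : 1 < s -> exists2 C, 0 < C & forall M N m, (0 < m)%N -> 0 < M ->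
  m%:R `^ (- s) * \sum_(0 <= p < N | prime p && (M <= (p * m)%:R)) ln p%:R * p%:R `^ (- s)
    <= C * (if m%:R <= M then M `^ (1 - s) / m%:R else m%:R `^ (- s)).
Proof.
move=> s_gt1; have [C C_gt0 prime_tail_le] := sum_prime_ln_powR_real_tail_le s_gt1.
exists C => // M N m m_gt0 M_gt0; have {}m_gt0 : 0 < m%:R :> R by rewrite ltr0n.
under [X in _ * X <= _]eq_bigl => p do rewrite natrM -ler_pdivrMr //.
have [m_le_M|M_lt_m] := leP m%:R M.
  rewrite -(@powRN_mul_div _ s M m%:R) // mulrCA ler_wpM2l ?powR_ge0 // prime_tail_le //.
  by rewrite ler_pdivlMr ?mul1r.
(* For m > M every prime p satisfies the condition p m >= M. *)
rewrite mulrC ler_wpM2r ?powR_ge0 //.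
have := prime_tail_le 1 N (lexx 1); rewrite powR1 mulr1; apply: le_trans.
apply: ler_sum_nat_subset => [p p_range /andP[p_prime _]|p _ _]; last first.
  by rewrite mulr_ge0 ?powR_ge0 ?ln_nat_ge0.
by rewrite p_range p_prime ler1n prime_gt0.
Qed.

Lemma ln_mul_almost_prime_tail_le_harmonic s : 1 < s -> exists2 C, 0 < C & forall l M N, 1 <= M ->
  ln M * almost_prime_tail l.+1 s M N <=
  C * (l.+1%:R * (M `^ (1 - s) * (almost_prime_harmonic R l (Num.truncn M).+1 + 1))).
Proof.
move=> s_gt1; have [C C_gt0 prime_tail_le] := powRN_mul_prime_tail_le s_gt1.
have [D D_gt0 tail_le] := sum_powR_real_tail_le s_gt1.
exists (C * (1 + D)) => [|l M N M_ge1]; first by rewrite mulr_gt0 // addr_gt0.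
have M_gt0 : 0 < M by lra.
apply: le_trans (ln_mul_almost_prime_tail_le l s N M_gt0) _.
rewrite mulrCA ler_wpM2l // -mulrA.
apply: (@le_trans _ _ (C * \sum_(0 <= m < N | almost_prime l m)
    (if m%:R <= M then M `^ (1 - s) / m%:R else m%:R `^ (- s)))).
  by rewrite mulr_sumr; apply: ler_sum => m /andP[m_gt0 _]; exact: prime_tail_le.
rewrite ler_wpM2l ?(ltW C_gt0) // (bigID (fun m => m%:R <= M)) /=.
have small_le : \sum_(0 <= m < N | almost_prime l m && (m%:R <= M)) M `^ (1 - s) / m%:R <=
    M `^ (1 - s) * almost_prime_harmonic R l (Num.truncn M).+1.
  rewrite -mulr_sumr ler_wpM2l ?powR_ge0 //.
  apply: ler_sum_nat_subset => [m m_range /andP[-> m_le_M]|m _ _].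
    by rewrite andbT ltnS truncn_ge_nat // ltW.
  by rewrite invr_ge0.
have large_le : \sum_(0 <= m < N | almost_prime l m && ~~ (m%:R <= M)) m%:R `^ (- s)
    <= D * M `^ (1 - s).
  apply: le_trans (tail_le M N M_ge1).
  apply: ler_sum_nat_subset => [m -> /andP[_]|m _ _]; last exact: powR_ge0.
  by rewrite -ltNge => /ltW.
rewrite (eq_bigr (fun m => M `^ (1 - s) / m%:R)) => [|m /andP[_ ->]//].
rewrite [X in _ + X <= _](eq_bigr (fun m => m%:R `^ (- s))) => [|m /andP[_ /negbTE->]//].
apply: le_trans (lerD small_le large_le) _.
have harmonic_ge0 := almost_prime_harmonic_ge0 R l (Num.truncn M).+1.
have := mulr_ge0 (ltW D_gt0) (mulr_ge0 (powR_ge0 M (1 - s)) harmonic_ge0).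
by have := powR_ge0 M (1 - s); lra.
Qed.

Lemma near_almost_prime_tail_le l s : 1 < s -> exists2 C, 0 < C &
  \forall M \near +oo, forall N, almost_prime_tail l.+1 s M N <= C * tail_order l s M.
Proof.
move=> s_gt1; have [C C_gt0 tail_le] := ln_mul_almost_prime_tail_le_harmonic s_gt1.
have [D D_gt0 harmonic_le] := near_almost_prime_harmonic_truncnS_le R l.
exists (C * l.+1%:R * (D + 1)); first by rewrite !mulr_gt0 // addr_gt0.
near=> M => N; have M_gt1 : 1 < M by near: M; exact: nbhs_pinfty_gt.
have lnM_gt0 := ln_gt0 M_gt1.
have lnln_ge1 : 1 <= ln (ln M) by near: M; exact: near_ln_ln_ge.
have harmonic_le_M : almost_prime_harmonic R l (Num.truncn M).+1 <= D * ln (ln M) ^+ l by near: M.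
rewrite -(ler_pM2l lnM_gt0); apply: le_trans (tail_le l M N (ltW M_gt1)) _.
have -> : ln M * (C * l.+1%:R * (D + 1) * tail_order l s M) =
    C * (l.+1%:R * (M `^ (1 - s) * (D * ln (ln M) ^+ l + ln (ln M) ^+ l))).
  by rewrite /tail_order; field; lra.
by rewrite !ler_wpM2l ?powR_ge0 ?(ltW C_gt0) // lerD // exprn_ege1.
Unshelve. all: by end_near. Qed.

End AlmostPrimeTail.

(** * Transfer to Stdlib's real numbers *)

Lemma RpowerE (x y : R) : 0 < x -> Rpower x y = x `^ y.
Proof. by move=> x_gt0; rewrite /Rpower RexpE RlnE RmultE /powR gt_eqF. Qed.

Lemma sum_n_P_term l (s M : R) N : sum_n (P_term l s M) N = almost_prime_tail l s M N.+1.
Proof.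
rewrite sum_n_Reals sum_f_R0E [RHS]big_mkcond; apply: eq_bigr => k _.
rewrite /P_term INRE; have [/= ap_k|//] := boolP (almost_prime l k).
have -> : (Rle_dec M k%:R : bool) = (M <= k%:R) by apply/idP/RleP; case: Rle_dec.
by case: ifP => // _; rewrite RpowerE ?powRN ?RinvE // ltr0n; case/andP: ap_k.
Qed.

Lemma Series_nneg_bounds (a : nat -> R) (B : R) :
  (forall n, 0 <= a n) -> (forall n, sum_n a n <= B) ->
  Series a <= B /\ forall n, sum_n a n <= Series a.
Proof.
move=> a_ge0 sum_le; have sum_leB n : Rle (sum_n a n) B by exact/RleP.
have sum_incr n : Rle (sum_n a n) (sum_n a n.+1).
  by apply/RleP; rewrite sum_Sn lerDl.
have sum_cvg : is_lim_seq (sum_n a) (Series a).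
  by apply: Series_correct; exact: ex_finite_lim_seq_incr _ _ sum_incr sum_leB.
split=> [|n]; apply/RleP.
  exact: is_lim_seq_le _ _ _ _ sum_leB sum_cvg (is_lim_seq_const B).
exact: is_lim_seq_incr_compare sum_cvg sum_incr n.
Qed.

Lemma near_P_sum_bounds l (s : R) : 1 < s -> exists2 C1, 0 < C1 & exists2 C2, 0 < C2 &
  \forall M \near +oo, C1 * tail_order l s M <= P_sum l.+1 s M <= C2 * tail_order l s M.
Proof.
move=> s_gt1; have [C1 C1_gt0 tail_ge] := near_almost_prime_tail_ge l (ltW s_gt1).
have [C2 C2_gt0 tail_le] := near_almost_prime_tail_le l s_gt1.
exists C1 => //; exists C2 => //; near=> M.
have [N tail_ge_N] : exists N, C1 * tail_order l s M <= almost_prime_tail l.+1 s M N by near: M.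
have tail_le_N n : almost_prime_tail l.+1 s M n <= C2 * tail_order l s M by move: n; near: M.
have term_ge0 n : 0 <= P_term l.+1 s M n.
  by rewrite /P_term; case: ifP => // _; rewrite RinvE invr_ge0 /Rpower RexpE expR_ge0.
have [|P_sum_le P_sum_ge] := Series_nneg_bounds term_ge0 (B := C2 * tail_order l s M).
  by move=> n; rewrite sum_n_P_term.
apply/andP; split=> //; apply: le_trans tail_ge_N _; apply: le_trans (P_sum_ge N).
rewrite sum_n_P_term; apply: ler_sum_nat_subset => [k /andP[_ k_lt] ->|k _ _]; last exact: powR_ge0.
by rewrite andbT /= ltnW.
Unshelve. all: by end_near. Qed.

Local Open Scope R_scope.

Lemma tail_orderE l (s M : R) : 0 < M ->
  tail_order l s M = Rpower.ln (Rpower.ln M) ^ l / (Rpower M (s - 1) * Rpower.ln M).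
Proof.
move=> /RltP M_gt0; rewrite RealsE RpowerE // /tail_order !RealsE; congr GRing.mul.
by rewrite invfM -powRN opprB.
Qed.

Lemma P_sum_bounds l (s : R) : 1 < s -> exists C1 C2 M0 : R, 0 < C1 /\ 0 < C2 /\
  forall M : R, M0 <= M ->
    C1 * tail_order l s M <= P_sum l.+1 s M /\ P_sum l.+1 s M <= C2 * tail_order l s M.
Proof.
move=> /RltP s_gt1; have [C1 C1_gt0 [C2 C2_gt0 [M0 [_ bounds]]]] := near_P_sum_bounds l s_gt1.
exists C1, C2, (M0 + 1); do 2![split; first exact/RltP].
move=> M /(Rlt_le_trans _ _ _ (Rlt_plus_1 M0)) /RltP.
by move=> /bounds /andP[lower upper]; split; apply/RleP.
Qed.

End AlmostPrimes.

Theorem theorem1p7 (l : nat) (s : R) :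
  (1 <= l)%nat -> 1 < s ->
  exists C1 C2 M0 : R, 0 < C1 /\ 0 < C2 /\
    forall M : R, 1 <= M -> M0 <= M ->
      C1 * ((ln (ln M)) ^ (l - 1) / (Rpower M (s - 1) * ln M)) <= P_sum l s M /\
      P_sum l s M <= C2 * ((ln (ln M)) ^ (l - 1) / (Rpower M (s - 1) * ln M)).
Proof.
  destruct l as [|l]; [easy | intros _ s_gt1].
  destruct (AlmostPrimes.P_sum_bounds l s_gt1) as (C1 & C2 & M0 & C1_gt0 & C2_gt0 & bounds).
  exists C1, C2, M0; do 2 (split; [assumption |]); intros M M_ge1 M_ge.
  rewrite Nat.sub_succ, Nat.sub_0_r, <- AlmostPrimes.tail_orderE by lra.
  now apply bounds.
Qed.
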